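(* For every prime $p\ge 5$, the trinomial coefficient satisfies $$T(2p,p)\equiv 2 \pmod{p^2}.$$
   Context: For an integer $n\ge 0$ and an integer $j$, the trinomial coefficient $T(n,j)$ is the coefficient of $x^j$ in the Laurent polynomial $(1+x+x^{-1})^n$, i.e. $(1+x+x^{-1})^n=\sum_{j=-n}^{n}T(n,j)x^j$ (and $T(n,j)=0$ for $|j|>n$). Equivalently, $T(n,j)=\sum_{k=0}^{n}\binom{n}{k}\binom{n-k}{k+j}$. *)

(* Defs.v *)
From HB Require Import structures.
From mathcomp Require Import all_boot all_order all_algebra zify.

Set Implicit Arguments.
Unset Strict Implicit.
Unset Printing Implicit Defensive.

Import Order.TTheory GRing.Theory Num.Theory.
Local Open Scope ring_scope.

(* Laurent polynomials over the integers are taken inside the field of        *)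
(* fractions of Z[x]: they are the fractions x^(-m) q with q in Z[x].         *)
Notation ratfun := {fraction {poly int}}.

Definition lX : ratfun := FracField.tofrac 'X.

Definition is_laurent (f : ratfun) : Prop :=
  exists mq : nat * {poly int}, f == lX ^- mq.1 * FracField.tofrac mq.2.

(* The result does not depend on the representation f = x^(-m) q picked by    *)
(* xchoose: see laurent_coefE.                                                *)
Definition laurent_coef (f : ratfun) (lf : is_laurent f) (j : int) : int :=
  let: (m, q) := xchoose lf in
  if (j + m%:Z)%R is Posz k then q`_k else 0.

Lemma lX_neq0 : lX != 0.
Proof. by rewrite tofrac_eq0 polyX_eq0. Qed.

Lemma laurent_coefE (f : ratfun) (lf : is_laurent f) (m : nat)
    (q : {poly int}) (j : int) :
  f = lX ^- m * FracField.tofrac q ->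
  laurent_coef lf j = if (j + m%:Z)%R is Posz k then q`_k else 0.
Proof.
move=> fE; rewrite /laurent_coef.
case: (xchoose lf) (xchooseP lf) => m1 q1 /= /eqP f1E.
have /eqP qE : FracField.tofrac ('X^m * q1) == FracField.tofrac ('X^m1 * q).
  rewrite !tofracM !tofracXn -/lX; apply/eqP.
  have h1 : FracField.tofrac q1 = lX ^+ m1 * f.
    by rewrite f1E mulrA divff ?mul1r // expf_neq0 ?lX_neq0.
  have h : FracField.tofrac q = lX ^+ m * f.
    by rewrite fE mulrA divff ?mul1r // expf_neq0 ?lX_neq0.
  by rewrite h1 h mulrCA.
move: qE => /eqP; rewrite tofrac_eq => /eqP qE.
case E : (j + (m + m1)%N%:Z) => [t|t]; last first.
  have -> : j + m1%:Z = - (t + 1 + m)%N%:Z by move: E; rewrite NegzE; lia.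
  have -> : j + m%:Z = - (t + 1 + m1)%N%:Z by move: E; rewrite NegzE; lia.
  by rewrite !addn1 !addSn.
have side (a b : nat) (r : {poly int}) : j + (a + b)%N%:Z = t%:Z ->
    (if j + b%:Z is Posz k then r`_k else 0) = ('X^a * r)`_t.
  move=> Et; rewrite coefXnM; case: ltnP => ta.
    have -> : j + b%:Z = - (a - t).-1.+1%N%:Z by lia.
    by rewrite -NegzE.
  by have -> : j + b%:Z = (t - a)%N%:Z by lia.
by rewrite (side m m1 q1 E) qE -(side m1 m) // addnC.
Qed.

Lemma trinomial_tofrac (n : nat) :
  (1 + lX + lX^-1) ^+ n
  = lX ^- n * FracField.tofrac ((1 + 'X + 'X ^+ 2) ^+ n).
Proof.
rewrite -exprVn tofracXn -exprMn; congr (_ ^+ n).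
rewrite !tofracD tofracXn tofrac1 -/lX !mulrDr mulr1 expr2 mulrA.
by rewrite mulVf ?lX_neq0 // mul1r addrC addrA.
Qed.

Lemma trinomial_laurent (n : nat) : is_laurent ((1 + lX + lX^-1) ^+ n).
Proof.
by exists (n, (1 + 'X + 'X ^+ 2) ^+ n); rewrite trinomial_tofrac.
Qed.

Definition trinomial (n : nat) (j : int) : int :=
  laurent_coef (trinomial_laurent n) j.

Lemma size_trinomial_poly (n : nat) :
  (size ((1 + 'X + 'X ^+ 2 : {poly int}) ^+ n) <= n.*2.+1)%N.
Proof.
apply: leq_trans (size_poly_exp_leq _ _) _; rewrite -mul2n ltnS leq_mul2r.
apply/orP; right; rewrite -subn1 leq_subLR.
rewrite (leq_trans (size_polyD _ _)) // geq_max size_polyXn andbT.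
by rewrite (leq_trans (size_polyD _ _)) // geq_max size_poly1 size_polyX.
Qed.

Lemma trinomial_out (n : nat) (j : int) : (n < `|j|)%N -> trinomial n j = 0.
Proof.
move=> nj; rewrite /trinomial (laurent_coefE _ _ (trinomial_tofrac n)).
case E : (j + n%:Z) => [k|] //; rewrite nth_default //.
by apply: leq_trans (size_trinomial_poly n) _; lia.
Qed.

Lemma trinomial_expansion (n : nat) :
  (1 + lX + lX^-1) ^+ n
  = \sum_(k < n.*2.+1) (trinomial n (k%:Z - n%:Z))%:~R * lX ^ (k%:Z - n%:Z).
Proof.
rewrite trinomial_tofrac.
have -> : (1 + 'X + 'X ^+ 2) ^+ n =
    \poly_(k < n.*2.+1) trinomial n (k%:Z - n%:Z) :> {poly int}.
  apply/polyP => k; rewrite coef_poly; case: ltnP => [_|nk].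
    by rewrite /trinomial (laurent_coefE _ _ (trinomial_tofrac n)) subrK.
  by rewrite nth_default // (leq_trans (size_trinomial_poly n)).
rewrite poly_def rmorph_sum mulr_sumr; apply: eq_bigr => k _ /=.
rewrite -[X in X *: _]intz -mul_polyC rmorph_int /= tofracM tofracXn rmorph_int.
by rewrite -/lX mulrCA; congr (_ * _); rewrite mulrC expfzDr ?lX_neq0 // exprnN.
Qed.

(* Main.v *)
(** Write [(1 + X + X^2)^p = 1 + X^p + X^(2p) + p G] and
    [(1 - X)^p = 1 - X^p + p U].  Squaring the first identity and reading off
    the coefficient of [X^(3p)] gives [T(2p, p) = 2 + 2 p G_p] modulo [p^2].
    The product of the two identities is [(1 - X^3)^p], whose coefficient of
    [X^p] vanishes because 3 does not divide [p]; hence [p] divides [G_p]. *)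

Require Import Defs.
From mathcomp Require Import all_boot all_order all_algebra.
From mathcomp Require Import zify ring.

Import GRing.Theory Num.Theory.
Local Open Scope ring_scope.

(** The inner binomial coefficients of a prime row are multiples of [p], so [c] is the inner part of
    the binomial sum with each of them divided by [p]. *)
Lemma exprD_prime (R : comNzRingType) (p : nat) (a b : R) :
  prime p -> exists c, (a + b) ^+ p = a ^+ p + b ^+ p + c *+ p.
Proof.
case: p => // -[//|n] pr_p; rewrite exprDn big_ord_recl big_ord_recr /=.
exists (\sum_(i < n.+1) (a ^+ (n.+2 - i.+1) * b ^+ i.+1)
          *+ ('C(n.+2, i.+1) %/ n.+2)).
rewrite subn0 expr0 mulr1 bin0 mulr1n subnn mul1r binn mulr1n.
rewrite -addrA [b ^+ _ + _]addrC; congr (_ + (_ + _)).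
rewrite -sumrMnl; apply: eq_bigr => i _ /=.
by rewrite -mulrnA divnK // prime_dvd_bin //= ltnS ltn_ord.
Qed.

(** Induction on [n]: in the convolution for [q * q ^+ n], an index above [d] on the left lies
    beyond [q], and one below [d] leaves an index beyond [q ^+ n]. *)
Lemma coef_exp_top (R : nzRingType) (q : {poly R}) (d n : nat) :
  (size q <= d.+1)%N -> (q ^+ n)`_(d * n) = q`_d ^+ n.
Proof.
move=> sq; elim: n => [|n IHn]; first by rewrite muln0 !expr0 coef1.
have sqn : (size (q ^+ n) <= (d * n).+1)%N.
  apply: leq_trans (size_poly_exp_leq _ _) _.
  by rewrite ltnS leq_mul2r -subn1 leq_subLR sq orbT.
have dlt : (d < (d * n.+1).+1)%N by rewrite ltnS mulnS leq_addr.
rewrite !exprS coefM (bigD1 (Ordinal dlt)) //= big1 => [|i neq_id].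
  by rewrite addr0 mulnS addKn IHn.
have [lt_di|] := ltnP d i; first by rewrite nth_default ?mul0r ?(leq_trans sq).
rewrite leq_eqVlt -val_eqE /= in neq_id *; rewrite (negPf neq_id) /= => lt_id.
by rewrite [X in _ * X]nth_default ?mulr0 // (leq_trans sqn) //; lia.
Qed.

(** The power is a polynomial in ['X^d], so only exponents divisible by [d] occur. *)
Lemma coef_exp1BXn (R : comNzRingType) (d n k : nat) :
  ~~ (d %| k)%N -> ((1 - 'X^d : {poly R}) ^+ n)`_k = 0.
Proof.
move=> ndk; rewrite exprDn coef_sum big1 // => i _.
rewrite coefMn expr1n mul1r exprNn -exprM -signr_odd.
have /negPf neq_k : k != (d * i)%N.
  by apply: contraNneq ndk => ->; rewrite dvdn_mulr.
by case: (odd i); rewrite ?expr0 ?expr1 ?mul1r ?mulN1r ?coefN coefXn neq_k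
   ?oppr0 mul0rn.
Qed.

Lemma coef0_exp (R : comNzRingType) (q : {poly R}) (n : nat) :
  (q ^+ n)`_0 = q`_0 ^+ n.
Proof. by rewrite -!horner_coef0 horner_exp. Qed.

Lemma trinomialE (n : nat) (j : nat) :
  trinomial n j%:Z = ((1 + 'X + 'X ^+ 2 : {poly int}) ^+ n)`_(j + n).
Proof. by rewrite /trinomial (laurent_coefE _ _ (trinomial_tofrac n)). Qed.

Theorem theorem1 (p : nat) (hp : prime p) (hp5 : (5 <= p)%N) :
  (trinomial (2 * p)%N p%:Z = 2 %[mod (p%:Z ^+ 2)])%Z.
Proof.
have p_odd : odd p by case: (even_prime hp) hp5 => [->|].
have p_gt0 : (0 < p)%N by rewrite prime_gt0.
pose Q : {poly int} := 1 + 'X + 'X ^+ 2.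
(* The binomial congruence is applied twice, first to [(1 + 'X) + 'X ^+ 2], then to [1 + 'X]. *)
have [G QpE] : exists G, Q ^+ p = 1 + 'X^p + 'X^(2 * p) + G *+ p.
  have [c1 E1] := exprD_prime _ _ (1 + 'X : {poly int}) ('X ^+ 2) hp.
  have [c2 E2] := exprD_prime _ _ (1 : {poly int}) 'X hp.
  exists (c1 + c2); rewrite /Q E1 E2 expr1n -exprM mulrnDl.
  by rewrite -!addrA; do 2!congr (_ + _); rewrite addrCA; congr (_ + _); rewrite addrC.
have [U LpE] : exists U, (1 - 'X) ^+ p = 1 - 'X^p + U *+ p :> {poly int}.
  have [c E] := exprD_prime _ _ (1 : {poly int}) (- 'X) hp.
  by exists c; rewrite E expr1n exprNn -signr_odd p_odd mulN1r.
have pI (x a : int) : a = a + x *+ p -> x = 0.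
  move=> /eqP; rewrite -subr_eq0 opprD addNKr oppr_eq0 mulrn_eq0.
  by rewrite eqn0Ngt p_gt0 => /eqP.
have size_Q : (size Q <= 3)%N by have := size_trinomial_poly 1; rewrite expr1.
(* The constant and top coefficients of [Q ^+ p] are both 1, already supplied by [1] and
   ['X^(2 * p)], so [G] vanishes at 0 and [2 * p]. It vanishes at [3 * p] because [Q ^+ p] has
   degree at most [2 * p]. *)
have G0 : G`_0 = 0.
  apply: (pI _ 1); have := coef0_exp _ Q p.
  rewrite QpE !(coefD, coefMn, coefXn, coef1, coefX) /= !addr0 expr1n.
  by rewrite !ltn_eqF ?muln_gt0 // !addr0.
have G2p : G`_(2 * p) = 0.
  apply: (pI _ 1); have := coef_exp_top _ Q 2 p size_Q.
  rewrite QpE !(coefD, coefMn, coefXn, coef1, coefX) /= add0r expr1n.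
  have [-> ->] : (2 * p == 0)%N = false /\ (2 * p == p)%N = false by lia.
  by rewrite eqxx add0r.
have G3p : G`_(3 * p) = 0.
  apply: (pI _ 0); rewrite add0r -coefMn.
  have -> : G *+ p = Q ^+ p - (1 + 'X^p + 'X^(2 * p)) by rewrite QpE; ring.
  rewrite coefB nth_default; last first.
    by apply: leq_trans (size_trinomial_poly p) _; lia.
  rewrite !(coefD, coefXn, coef1).
  have [-> ->] : (3 * p == 0)%N = false /\ (3 * p == p)%N = false by lia.
  by rewrite (_ : (3 * p == 2 * p)%N = false) //; lia.
have U0 : U`_0 = 0.
  apply: (pI _ 1); have := coef0_exp _ (1 - 'X : {poly int}) p.
  rewrite LpE !(coefD, coefN, coefMn, coefXn, coef1, coefX) /= !oppr0 !addr0.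
  by rewrite expr1n ltn_eqF // oppr0 addr0.
(* As [p] is odd, the top coefficient of [(1 - 'X) ^+ p] is -1, which [- 'X^p] already supplies. *)
have Up : U`_p = 0.
  have size_L : (size (1 - 'X : {poly int})%R <= 2)%N.
    by rewrite -opprB size_polyN -polyC1 size_XsubC.
  apply: (pI _ (-1)); have := coef_exp_top _ _ 1 p size_L; rewrite mul1n.
  rewrite LpE !(coefD, coefN, coefMn, coefXn, coef1, coefX) /= eqxx add0r.
  by rewrite gtn_eqF // add0r -signr_odd p_odd.
have GpE : G`_p = - (U * G)`_p *+ p.
  have n3p : ~~ (3 %| p)%N.
    by rewrite dvdn_prime2 //; case: eqP hp5 => // <-.
  have := coef_exp1BXn int 3 p p n3p.
  have -> : (1 - 'X^3) ^+ p = (1 - 'X) ^+ p * Q ^+ p :> {poly int}.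
    by rewrite -exprMn; congr (_ ^+ _); rewrite /Q; ring.
  (* The main terms telescope as [(1 - Y) * (1 + Y + Y ^+ 2) = 1 - Y ^+ 3] with [Y = 'X^p]. At
     degree [p], the zeros of [U] and [G] found above leave only [G]_p + (U * G)[_p *+ p] in the
     bracket. *)
  have -> : (1 - 'X) ^+ p * Q ^+ p = 1 - 'X^(3 * p) +
     (U + U * 'X^p + U * 'X^(2 * p) + G - G * 'X^p + (U * G) *+ p) *+ p.
    rewrite LpE QpE !(mulnC _ p) !exprM; ring.
  rewrite !(coefD, coefN, coefMn _ p, coefMXn, coefXn, coef1) ltnn subnn.
  have [-> -> ->] : [/\ (p < 2 * p)%N, (p == 0)%N = false
    & (p == 3 * p)%N = false] by split; lia.
  rewrite U0 Up G0 !(subr0, addr0, add0r) => /esym.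
  by rewrite -[RHS]add0r => /pI/eqP; rewrite addr_eq0 mulNrn => /eqP.
apply/eqP; rewrite eqz_mod_dvd; apply/dvdzP.
exists ((G ^+ 2)`_(3 * p) - (U * G)`_p *+ 2).
rewrite trinomialE -/Q (_ : (p + 2 * p = 3 * p)%N); last by lia.
have -> : Q ^+ (2 * p) = 1 + 'X^p *+ 2 + 'X^(2 * p) *+ 3 + 'X^(3 * p) *+ 2
   + 'X^(4 * p) + (G + G * 'X^p + G * 'X^(2 * p)) *+ 2 *+ p + G ^+ 2 *+ p *+ p.
  by rewrite (mulnC 2) exprM QpE !(mulnC _ p) !exprM; ring.
rewrite !(coefD, coefMn, coefMXn, coefXn, coef1) eqxx.
have [-> ->] : (3 * p - p = 2 * p)%N /\ (3 * p - 2 * p = p)%N by lia.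
rewrite G2p G3p GpE.
have [-> -> ->] : [/\ (3 * p == 0)%N = false, (3 * p == p)%N = false
  & (3 * p == 2 * p)%N = false] by split; lia.
have [-> -> ->] : [/\ (3 * p == 4 * p)%N = false, (3 * p < p)%N = false
  & (3 * p < 2 * p)%N = false] by split; lia.
by rewrite /= -[p%:Z]natz; ring.
Qed.
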